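(* Let $\mathbf{A}$ be a semilattice and let $\mathcal{F}\subseteq C_{\mathcal{K}_\mathbf{A}}(X(\mathbf{A}))$ be a lower-Vietoris-type family of the dual $S$-space $\langle X(\mathbf{A}),\mathcal{K}_\mathbf{A}\rangle$. Let $\theta_\mathcal{F}=\{(a,b)\in A^2\colon [\beta(a)^c]^-_\mathcal{F}=[\beta(b)^c]^-_\mathcal{F}\}$. Then: (1) $\theta_\mathcal{F}$ is a congruence on $\mathbf{A}$; in particular, $\theta_\mathcal{F}$ is the kernel of the homomorphism $\Box_{R_\mathcal{F}}\beta\colon A\to S(\mathcal{F})$. (2) $Y\in\mathcal{F}$ if and only if there exists $Q\in X(\mathbf{A}/\theta_\mathcal{F})$ such that $Y=R_{q_{\theta_\mathcal{F}}}(Q)$. Moreover, $\mathcal{F}=\mathcal{F}_{R_{q_{\theta_\mathcal{F}}}}$.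
   Context: A semilattice is a meet-semilattice with top. A proper filter is irreducible if it is not the intersection of two filters both different from it; $X(\mathbf{B})$ is the set of irreducible filters of a semilattice $\mathbf{B}$, $\beta(a)=\{P\in X(\mathbf{A})\colon a\in P\}$, $\mathcal{K}_\mathbf{A}=\{\beta(a)^c\colon a\in A\}$ is a subbase; $S(X(\mathbf{A}))=\{\beta(a)\colon a\in A\}$, $C_{\mathcal{K}_\mathbf{A}}(X(\mathbf{A}))$ is the set of arbitrary intersections of sets $\beta(a)$. An $S$-space is a pair $\langle X,\mathcal{K}\rangle$, $\mathcal{K}$ a subbase, such that with $S(X)=\{U^c\colon U\in\mathcal{K}\}$ and $C_\mathcal{K}(X)$ the intersections of subfamilies of $S(X)$: (S1) $T_0$, $X=\bigcup\mathcal{K}$; (S2) $\mathcal{K}$ consists of compact opens, closed under finite unions, $\emptyset\in\mathcal{K}$; (S3) for $U,V\in\mathcal{K}$, $x\in U\cap V$, there are $W,D\in\mathcal{K}$, $x\notin W$, $x\in D$, $D\subseteq(U\cap V)\cup W$; (S4) if $Y\in C_\mathcal{K}(X)$ and $\mathcal{J}\subseteq S(X)$ is a $Y$-family (for $A,B\in\mathcal{J}$ there are $H\in S(X)$, $C\in\mathcal{J}$ with $Y\subseteq H$, $A\cap H\subseteq C$, $B\cap H\subseteq C$) with $Y\cap A^c\ne\emptyset$ for all $A\in\mathcal{J}$, then $Y\cap\bigcap\{A^c\colon A\in\mathcal{J}\}\ne\emptyset$. For a family $\mathcal{F}$ of subsets and a set $U$, $U^-_\mathcal{F}=\{Y\in\mathcal{F}\colon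 Y\cap U\neq\emptyset\}$. $\mathcal{F}$ is a lower-Vietoris-type family if it consists of nonempty sets in $C_{\mathcal{K}_\mathbf{A}}(X(\mathbf{A}))$ and $\langle\mathcal{F},\{U^-_\mathcal{F}\colon U\in\mathcal{K}_\mathbf{A}\}\rangle$ is an $S$-space; $S(\mathcal{F})=\{(U^-_\mathcal{F})^c\colon U\in\mathcal{K}_\mathbf{A}\}$, a semilattice under $\cap$. $R_\mathcal{F}\subseteq\mathcal{F}\times X(\mathbf{A})$ is given by $(Y,P)\in R_\mathcal{F}$ iff $P\in Y$, and $\Box_{R_\mathcal{F}}(U)=\{Y\in\mathcal{F}\colon R_\mathcal{F}(Y)\subseteq U\}$. For a congruence $\theta$, $q_\theta\colon A\to A/\theta$ is the natural map and $R_{q_\theta}\subseteq X(\mathbf{A}/\theta)\times X(\mathbf{A})$ is $(Q,P)\in R_{q_\theta}$ iff $q_\theta^{-1}[Q]\subseteq P$; $\mathcal{F}_{R_{q_\theta}}=\{R_{q_\theta}(Q)\colon Q\in X(\mathbf{A}/\theta)\}$. *)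

(* Defs.v *)
From HB Require Import structures.
From mathcomp Require Import all_boot all_order.
From mathcomp Require Import generic_quotient.
From mathcomp Require Import boolp classical_sets topology.

Set Implicit Arguments.
Unset Strict Implicit.
Unset Printing Implicit Defensive.

Import Order.Theory.
Local Open Scope classical_set_scope.

Section Filters.
Context {d : Order.disp_t} (A : tMeetSemilatticeType d).

Definition sl_filter (G : set A) : Prop :=
  [/\ G \top%O,
      forall a b, (a <= b)%O -> G a -> G b
    & forall a b, G a -> G b -> G (Order.meet a b)].

Definition irreducible (P : set A) : Prop :=
  [/\ sl_filter P, P <> setT
    & ~ exists G H : set A,
        [/\ sl_filter G, sl_filter H, P = G `&` H, G <> P & H <> P]].

(* The type of points of X(A); [val P : set A] is the underlying filter. *)
Definition dual_space : Type := set_type (irreducible : set (set A)).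

HB.instance Definition _ := Choice.on dual_space.

Definition beta (a : A) : set dual_space := [set P | val P a].

Definition dual_subbase : set (set dual_space) := [set ~` beta a | a in setT].

End Filters.
Arguments dual_space {d} A.
Arguments dual_subbase {d} A.

(* K is only used as the subbase generating the topology of this copy of X. *)
Definition subbase_space (X : choiceType) (K : set (set X)) : Type := X.

Section SubbaseSpace.
Context (X : choiceType) (K : set (set X)).
HB.instance Definition _ := Choice.on (subbase_space K).
HB.instance Definition _ :=
  @isSubBaseTopological.Build (subbase_space K) (set X) K id.
End SubbaseSpace.

Section SSpaces.
Context {X : choiceType}.
Implicit Types (K J : set (set X)) (Y : set X).

Definition compl_family K : set (set X) := [set ~` U | U in K].

Definition closed_family K : set (set X) :=
  [set Y | exists2 J, J `<=` compl_family K & Y = \bigcap_(B in J) B].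

(* Nonemptiness of J has to be part of the notion: for J = set0 and
   Y = set0, which lies in [closed_family K] as soon as K covers X, axiom
   (S4) would fail in every space. *)
Definition Y_family K Y J : Prop :=
  [/\ J !=set0, J `<=` compl_family K
    & forall B1 B2, J B1 -> J B2 ->
      exists H C, [/\ compl_family K H, J C, Y `<=` H,
                      B1 `&` H `<=` C & B2 `&` H `<=` C]].

Record S_space K : Prop := {
  S1_T0 : kolmogorov_space (subbase_space K) ;
  S1_cover : \bigcup_(U in K) U = setT ;
  S2_open : forall U, K U -> open (U : set (subbase_space K)) ;
  S2_compact : forall U, K U -> compact (U : set (subbase_space K)) ;
  S2_union : forall U V, K U -> K V -> K (U `|` V) ;
  S2_empty : K set0 ;
  S3 : forall U V x, K U -> K V -> (U `&` V) x ->
    exists W D, [/\ K W, K D, ~ W x, D x & D `<=` (U `&` V) `|` W] ;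
  S4 : forall Y J, closed_family K Y -> Y_family K Y J ->
    (forall B, J B -> Y `&` ~` B !=set0) ->
    Y `&` \bigcap_(B in J) ~` B !=set0
}.

(* U^-_F, as a set of elements of F *)
Definition hit (F : set (set X)) (U : set X) : set F :=
  [set Y | val Y `&` U !=set0].

Definition hit_family K (F : set (set X)) : set (set F) :=
  [set @hit F U | U in K].

End SSpaces.
Arguments hit {X} F U.
Arguments hit_family {X} K F.

Section Relations.
Context {S T : Type} (R : S -> T -> Prop).

Definition rel_image (x : S) : set T := [set y | R x y].

Definition Box (U : set T) : set S := [set x | rel_image x `<=` U].

Definition rel_family : set (set T) := [set rel_image x | x in setT].

End Relations.

Definition sl_hom {d d' : Order.disp_t} {A : tMeetSemilatticeType d}
    {B : tMeetSemilatticeType d'} (f : A -> B) : Prop :=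
  {morph f : a b / Order.meet a b} /\ f \top%O = \top%O.

Record congruence {d : Order.disp_t} {A : tMeetSemilatticeType d}
    (theta : A -> A -> Prop) : Prop := {
  cong_refl : forall a, theta a a ;
  cong_sym : forall a b, theta a b -> theta b a ;
  cong_trans : forall a b c, theta a b -> theta b c -> theta a c ;
  cong_meet : forall a a' b b', theta a a' -> theta b b' ->
    theta (Order.meet a b) (Order.meet a' b')
}.

Fact quotient_display : Order.disp_t -> Order.disp_t. Proof. by []. Qed.

Section Quotient.
Local Open Scope quotient_scope.
Context {d : Order.disp_t} {A : tMeetSemilatticeType d}.
Context {theta : A -> A -> Prop} (Htheta : congruence theta).

Definition cong_rel of congruence theta : rel A := fun a b => `[< theta a b >].

Lemma cong_rel_refl : reflexive (cong_rel Htheta).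
Proof. by move=> a; apply/asboolP; exact: cong_refl. Qed.

Lemma cong_rel_sym : symmetric (cong_rel Htheta).
Proof. by move=> a b; apply/asboolP/asboolP; exact: cong_sym. Qed.

Lemma cong_rel_trans : transitive (cong_rel Htheta).
Proof.
by move=> b a c /asboolP ab /asboolP bc; apply/asboolP; exact: cong_trans ab bc.
Qed.

Canonical cong_equiv :=
  EquivRel (cong_rel Htheta) cong_rel_refl cong_rel_sym cong_rel_trans.

Definition quotient : Type := {eq_quot cong_equiv}.

HB.instance Definition _ := Choice.on quotient.

Definition qmap (a : A) : quotient := \pi_{eq_quot cong_equiv} a.

Lemma qmap_eq a b : qmap a = qmap b <-> theta a b.
Proof.
by split=> [/eqmodP/asboolP|ab]; [|apply/eqmodP/asboolP].
Qed.

Definition qrepr (x : quotient) : A := repr (x : {eq_quot cong_equiv}).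

Lemma qreprK : cancel qrepr qmap.
Proof. by move=> x; exact: reprK. Qed.

Definition qmeet (x y : quotient) : quotient :=
  qmap (Order.meet (qrepr x) (qrepr y)).

Definition qle (x y : quotient) : bool := qmeet x y == x.

Lemma qmeetE a b : qmeet (qmap a) (qmap b) = qmap (Order.meet a b).
Proof.
by apply/qmap_eq/(cong_meet Htheta); apply/qmap_eq; rewrite qreprK.
Qed.

Lemma qmeetC : commutative qmeet.
Proof. by move=> x y; rewrite /qmeet meetC. Qed.

Lemma qmeetA : associative qmeet.
Proof.
move=> x y z; rewrite -(qreprK x) -(qreprK y) -(qreprK z).
by rewrite !qmeetE meetA.
Qed.

Lemma qmeetxx x : qmeet x x = x.
Proof. by rewrite /qmeet meetxx qreprK. Qed.

Lemma qle_refl : reflexive qle.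
Proof. by move=> x; rewrite /qle qmeetxx. Qed.

Lemma qle_anti : antisymmetric qle.
Proof. by move=> x y /andP[/eqP xy /eqP yx]; rewrite -xy qmeetC yx. Qed.

Lemma qle_trans : transitive qle.
Proof.
move=> y x z /eqP xy /eqP yz; apply/eqP.
by rewrite -[in LHS]xy -qmeetA yz.
Qed.

HB.instance Definition _ := Order.Le_isPOrder.Build (quotient_display d)
  quotient qle_refl qle_anti qle_trans.

HB.instance Definition _ := Order.POrder_Meet_isSemilattice.Build
  (quotient_display d) quotient qmeetC qmeetA (fun _ _ => erefl).

Lemma qlex1 (x : quotient) : (x <= qmap \top)%O.
Proof.
by apply/eqP; rewrite -[x]qreprK qmeetE meetx1.
Qed.

HB.instance Definition _ :=
  Order.hasTop.Build (quotient_display d) quotient qlex1.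

Lemma qmap_hom : sl_hom qmap.
Proof. by split=> // a b; exact/esym/qmeetE. Qed.

(* R_q, between the dual space of A/theta and that of A *)
Definition quotient_rel (Q : dual_space quotient) (P : dual_space A) : Prop :=
  qmap @^-1` val Q `<=` val P.

End Quotient.
Arguments quotient_rel {d A theta} Htheta Q P.

Section LowerVietoris.
Context {d : Order.disp_t} {A : tMeetSemilatticeType d}.
Context (F : set (set (dual_space A))).

Definition lower_Vietoris : Prop :=
  [/\ F `<=` closed_family (dual_subbase A),
      forall Y, F Y -> Y !=set0
    & S_space (hit_family (dual_subbase A) F)].

(* S(F) *)
Definition S_of : set (set F) := compl_family (hit_family (dual_subbase A) F).

(* R_F *)
Definition mem_rel (Y : F) (P : dual_space A) : Prop := val Y P.

Definition theta_of (a b : A) : Prop := hit F (~` beta a) = hit F (~` beta b).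

End LowerVietoris.
Arguments S_of {d A} F.
Arguments mem_rel {d A} F Y P.
Arguments theta_of {d A} F a b.

(* Main.v *)
Require Import Defs.
From mathcomp Require Import all_boot all_order.
From mathcomp Require Import boolp classical_sets topology.

(** Write [s a] for the set of members of F contained in [beta a]; it is the
    complement of [hit F (~` beta a)], so a |-> s a identifies A / theta_F with
    S(F).  A closed set Y is the intersection of the [beta a] containing it,
    hence Y = R_q(Q) as soon as the preimage of Q in A is
    [cover_filter Y] = {a | Y is contained in beta a}.  It remains to see that
    the filters [cover_filter Y], Y in F, are exactly the preimages of the
    irreducible filters of A / theta_F: they are irreducible by (S3), and every
    irreducible filter is of this form by (S4), whose hypotheses follow from
    the compactness part of (S2). *)

Set Implicit Arguments.
Unset Strict Implicit.
Unset Printing Implicit Defensive.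

Import Order.Theory.
Local Open Scope classical_set_scope.

(** * An elementwise criterion for irreducibility of filters *)

Section IrreducibleFilters.
Context {d : Order.disp_t} {A : tMeetSemilatticeType d}.
Implicit Types (a b c h : A) (P G : set A).

(** For a filter [G], this is the filter generated by [G] and [b]. *)
Definition filter_adjoin G b : set A :=
  [set c | exists2 h, G h & (Order.meet b h <= c)%O].

Lemma filter_adjoin_filter G b : sl_filter G -> sl_filter (filter_adjoin G b).
Proof.
move=> [G1 Gup GI]; split.
- by exists \top%O; rewrite ?lex1.
- by move=> x y xy [h Gh bh]; exists h => //; exact: le_trans bh xy.
- move=> x y [h Gh bh] [k Gk bk]; exists (Order.meet h k); first exact: GI.
  rewrite lexI; apply/andP; split.
    by apply: le_trans bh; rewrite leI2// leIl.
  by apply: le_trans bk; rewrite leI2// leIr.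
Qed.

Lemma sub_filter_adjoin G b : G `<=` filter_adjoin G b.
Proof. by move=> h Gh; exists h => //; rewrite leIr. Qed.

Lemma mem_filter_adjoin G b : sl_filter G -> filter_adjoin G b b.
Proof. by case=> G1 _ _; exists \top%O; rewrite ?meetx1. Qed.

(** If [h] and [c] are missing for [a] and [b], the filters generated by [P] with [a] and by [P]
    with [b] intersect in [P]. Conversely, for [P] the intersection of [G] and [H], take [a] in [G]
    and [b] in [H], both outside [P]: the resulting [c] lies in both filters, hence in [P]. *)
Lemma irreducibleP P : irreducible P <->
  [/\ sl_filter P, P <> setT
    & forall a b, ~ P a -> ~ P b ->
      exists h c, [/\ P h, ~ P c, (Order.meet a h <= c)%O
                    & (Order.meet b h <= c)%O]].
Proof.
split=> [[Pf PT Pirr]|[Pf PT Pdir]].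
  split=> // a b Pa Pb; apply: contrapT => nex; apply: Pirr.
  exists (filter_adjoin P a), (filter_adjoin P b).
  split; [exact: filter_adjoin_filter|exact: filter_adjoin_filter| | |].
  - apply/seteqP; split=> [c Pc|c [[h Ph ah] [k Pk bk]]].
      by split; exact: sub_filter_adjoin.
    (* The meet of [h] and [k] stays in [P] and serves both inequalities at once. *)
    apply: contrapT => Pc; apply: nex; exists (Order.meet h k), c.
    case: (Pf) => _ _ PI; split=> //; first exact: PI.
      by apply: le_trans ah; rewrite leI2// leIl.
    by apply: le_trans bk; rewrite leI2// leIr.
  - by move=> e; apply: Pa; rewrite -e; exact: mem_filter_adjoin.
  - by move=> e; apply: Pb; rewrite -e; exact: mem_filter_adjoin.
split=> // -[G [H [Gf Hf PGH GP HP]]].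
have PG : P `<=` G by rewrite PGH => x [].
have PH : P `<=` H by rewrite PGH => x [].
have [a [Ga Pa]] : exists a, G a /\ ~ P a.
  apply: contrapT => nex; apply: GP; apply/seteqP; split=> // x Gx.
  by apply: contrapT => Px; apply: nex; exists x.
have [b [Hb Pb]] : exists b, H b /\ ~ P b.
  apply: contrapT => nex; apply: HP; apply/seteqP; split=> // x Hx.
  by apply: contrapT => Px; apply: nex; exists x.
have [h [c [Ph Pc ahc bhc]]] := Pdir _ _ Pa Pb.
case: Gf Hf => _ Gup GI [_ Hup HI]; apply: Pc; rewrite PGH; split.
  by apply: Gup ahc _; apply: GI => //; exact: PG.
by apply: Hup bhc _; apply: HI => //; exact: PH.
Qed.

End IrreducibleFilters.

(** * Closed sets of X(A) and their cover filters *)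

Section DualSpace.
Context {d : Order.disp_t} {A : tMeetSemilatticeType d}.
Implicit Types (a b : A) (P : dual_space A) (Y : set (dual_space A)).

Lemma dual_irreducible P : irreducible (val P).
Proof. exact: (set_valP P). Qed.

Lemma beta_top : beta (\top%O : A) = setT.
Proof. by apply/seteqP; split=> // P _; have [[]] := dual_irreducible P. Qed.

Lemma betaI a b : beta (Order.meet a b) = beta a `&` beta b.
Proof.
apply/seteqP; split=> P; have [[_ Pup PI] _ _] := dual_irreducible P.
  by move=> Pab; split; apply: Pup Pab; rewrite ?leIl ?leIr.
by move=> [Pa Pb]; exact: PI.
Qed.

Definition cover_filter Y : set A := [set a | Y `<=` beta a].

Lemma cover_filterI Y a b :
  cover_filter Y (Order.meet a b) <-> cover_filter Y a /\ cover_filter Y b.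
Proof. by rewrite /cover_filter /= betaI subsetI. Qed.

Lemma closed_family_cover Y : closed_family (dual_subbase A) Y ->
  Y = [set P | cover_filter Y `<=` val P].
Proof.
move=> [J JK YJ]; apply/seteqP; split=> [P YP a|P sP]; first exact.
rewrite YJ => B JB; have [_ [a _ <-] aB] := JK _ JB.
move: JB; rewrite -aB setCK => JB; apply: sP.
by rewrite /cover_filter/= YJ; exact: bigcap_inf.
Qed.

Lemma cover_filter_proper Y : Y !=set0 -> cover_filter Y <> setT.
Proof.
move=> [P YP] YT; have [_ PT _] := dual_irreducible P; apply: PT.
apply/seteqP; split=> // a _; have Ya : cover_filter Y a by rewrite YT.
exact: Ya.
Qed.

End DualSpace.

(** * The semilattice S(F) and the order of A / theta_F *)

Section Family.
Context {d : Order.disp_t} {A : tMeetSemilatticeType d}.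
Context (F : set (set (dual_space A))).
Implicit Types (a b : A) (Y : F).

Local Notation s a := (Box (mem_rel F) (beta a)).
Local Notation KF := (hit_family (dual_subbase A) F).

Lemma hit_setC U : hit F (~` U) = ~` Box (mem_rel F) U.
Proof.
apply/seteqP; split=> Y; first by case=> P [YP UP] YU; exact/UP/YU.
move=> YU; apply: contrapT => nex; apply: YU => P YP.
by apply: contrapT => UP; apply: nex; exists P.
Qed.

Lemma Box_beta_top : s \top%O = setT.
Proof. by rewrite beta_top; apply/seteqP; split. Qed.

(** Membership of [Y] in [s a] unfolds to [cover_filter (val Y) a]. *)
Lemma Box_betaI a b : s (Order.meet a b) = s a `&` s b.
Proof. by apply/seteqP; split=> Y /cover_filterI. Qed.

Lemma theta_ofE a b : theta_of F a b <-> s a = s b.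
Proof.
rewrite /theta_of !hit_setC; split=> [/(congr1 setC)|->//].
by rewrite !setCK.
Qed.

Lemma hit_family_beta a : KF (~` s a).
Proof. by exists (~` beta a); [exists a|rewrite hit_setC]. Qed.

Lemma hit_familyP U : KF U -> exists a, U = ~` s a.
Proof. by move=> [_ [a _ <-] <-]; exists a; rewrite hit_setC. Qed.

Lemma S_of_beta a : S_of F (s a).
Proof. by exists (~` s a); [exact: hit_family_beta|rewrite setCK]. Qed.

Lemma theta_of_congruence : congruence (theta_of F).
Proof.
split=> [a|a b ab|a b c ab bc|a a' b b'].
- by [].
- exact: esym.
- exact: etrans ab bc.
- by move=> /theta_ofE aa' /theta_ofE bb'; apply/theta_ofE; rewrite !Box_betaI aa' bb'.
Qed.

Lemma le_qmapE (hc : congruence (theta_of F)) a b :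
  (qmap hc a <= qmap hc b)%O <-> s a `<=` s b.
Proof.
have qI : Order.meet (qmap hc a) (qmap hc b) = qmap hc (Order.meet a b).
  exact: qmeetE.
split=> [/meet_idPl|ab]; rewrite ?leEmeet ?qI.
  by move=> /qmap_eq/theta_ofE <-; rewrite Box_betaI => Y [].
apply/eqP/qmap_eq/theta_ofE; rewrite Box_betaI; exact/setIidPl.
Qed.

End Family.

(** * Members of F against irreducible filters of A / theta_F *)

Section Theorem12.
Context {d : Order.disp_t} {A : tMeetSemilatticeType d}.
Context (F : set (set (dual_space A))) (hF : lower_Vietoris F).
Context (hc : congruence (theta_of F)).

Local Notation s a := (Box (mem_rel F) (beta a)).
Local Notation KF := (hit_family (dual_subbase A) F).
Local Notation q := (qmap hc).
Local Notation A' := (quotient hc).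

(** Since [Y] is a point of [F], the equality [s a = s b] can be evaluated at it. *)
Lemma cover_filter_theta (Y : set (dual_space A)) a b : F Y -> q a = q b ->
  cover_filter Y a -> cover_filter Y b.
Proof.
move=> FY /qmap_eq/theta_ofE sab Ya.
have : s a (SigSub (mem_set FY)) by [].
by rewrite sab.
Qed.

Lemma rel_image_cover (Q : dual_space A') (Y : set (dual_space A)) :
  F Y -> q @^-1` val Q = cover_filter Y ->
  Y = rel_image (quotient_rel hc) Q.
Proof.
case: hF => Fcl _ _ FY QY; rewrite [LHS]closed_family_cover; last exact: Fcl.
by rewrite -QY.
Qed.

Lemma cover_filter_irreducible (Y : set (dual_space A)) : F Y ->
  irreducible (q @` cover_filter Y : set A').
Proof.
move=> FY; have [_ F0 SF] := hF.
have memq a : (q @` cover_filter Y) (q a) <-> cover_filter Y a.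
  split=> [[b Yb ba]|Ya]; first exact: cover_filter_theta ba Yb.
  by exists a.
apply/irreducibleP; split.
- split.
  + by exists \top%O => //; rewrite /cover_filter/= beta_top.
  + move=> x y; rewrite -(qreprK x) -(qreprK y) => /le_qmapE xy /memq Yx.
    by apply/memq; exact: (xy (SigSub (mem_set FY))).
  + move=> x y; rewrite -(qreprK x) -(qreprK y) => /memq Yx /memq Yy.
    have -> : Order.meet (q (qrepr x)) (q (qrepr y)) =
              q (Order.meet (qrepr x) (qrepr y)) by exact: qmeetE.
    by apply/memq/cover_filterI.
- move=> QT; apply: (cover_filter_proper (F0 _ FY)); apply/seteqP.
  by split=> // a _; apply/memq; rewrite QT.
- move=> x y; rewrite -(qreprK x) -(qreprK y).
  set a := qrepr x; set b := qrepr y => Ya Yb.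
  pose Y' : F := SigSub (mem_set FY).
  have Y'ab : (~` s a `&` ~` s b) Y' by split=> [sa|sb]; [apply/Ya/memq|apply/Yb/memq].
  (* Complementing the inclusion of (S3) gives that [s a] and [s b], each cut down to [s w], lie in
     [s c]. This is the condition of [irreducibleP] with [h = q w] and [c = q c]. *)
  have [_ [_ [/hit_familyP[w ->] /hit_familyP[c ->] Yw Yc sub]]] :=
    S3 SF (hit_family_beta F a) (hit_family_beta F b) Y'ab.
  have qI u v : Order.meet (q u) (q v) = q (Order.meet u v) by exact: qmeetE.
  exists (q w), (q c); split.
  + by apply/memq; apply: contrapT.
  + by move=> /memq /Yc.
  + rewrite qI; apply/le_qmapE; rewrite Box_betaI => Z [Za Zw].
    by apply: contrapT => /sub [[]|].
  + rewrite qI; apply/le_qmapE; rewrite Box_betaI => Z [Zb Zw].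
    by apply: contrapT => /sub [[]|].
Qed.

(* The finite-subcover argument, run on the filter generated by the sets
   [s a `\` s b] with [a] in [G]. *)
Lemma Box_beta_compact (G : set A) b : G !=set0 ->
  (forall a1 a2, G a1 -> G a2 -> G (Order.meet a1 a2)) ->
  \bigcap_(a in G) s a `<=` s b -> exists2 a, G a & s a `<=` s b.
Proof.
move=> [a0 Ga0] GI sub; have [_ _ SF] := hF.
apply: contrapT => nex.
pose Phi : set (set (subbase_space KF)) :=
  [set Z | exists2 a, G a & s a `\` s b `<=` Z].
have Phi_filter : ProperFilter Phi.
  split.
    move=> [a Ga ab]; apply: nex; exists a => // Y Ya.
    by apply: contrapT => Yb; exact: (ab Y).
  split.
  - by exists a0.
  - move=> Z1 Z2 [a1 Ga1 sa1] [a2 Ga2 sa2].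
    exists (Order.meet a1 a2); first exact: GI.
    by rewrite Box_betaI => Y [[Y1 Y2] Yb]; split; [apply: sa1|apply: sa2].
  - by move=> Z1 Z2 Z12 [a Ga sa]; exists a => //; exact: subset_trans sa Z12.
have Phib : Phi (~` s b) by exists a0 => // Y [].
(* The cluster point [Y] is outside [s b]. It lies in every [s a] with [a] in [G], because [s a]
   belongs to [Phi] and has an open complement; this contradicts [sub]. *)
have [Y [Yb Ycl]] := S2_compact SF (hit_family_beta F b) Phi_filter Phib.
apply/Yb/sub => a Ga; apply: contrapT => Ya.
have /Ycl : Phi (s a) by exists a => // Z [].
have : nbhs (Y : subbase_space KF) (~` s a).
  by apply: open_nbhs_nbhs; split=> //; exact: S2_open SF _ (hit_family_beta F a).
by move=> /[swap] /[apply] -[Z []].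
Qed.

Lemma irreducible_cover (Q : dual_space A') :
  exists2 Y, F Y & q @^-1` val Q = cover_filter Y.
Proof.
have [_ _ SF] := hF.
have /irreducibleP[[Q1 Qup QI] QT Qdir] := dual_irreducible Q.
pose G : set A := q @^-1` val Q.
have qI u v : Order.meet (q u) (q v) = q (Order.meet u v) by exact: qmeetE.
have GI a1 a2 : G a1 -> G a2 -> G (Order.meet a1 a2).
  by move=> G1 G2; rewrite /G/= -qI; exact: QI.
(* A point of [Y0] outside all members of [J] has cover filter exactly [G]; (S4) will supply one. *)
pose Y0 := \bigcap_(a in G) s a.
pose J : set (set F) := [set s b | b in ~` G].
have clY0 : closed_family KF Y0.
  exists [set s a | a in G]; first by move=> _ [a _ <-]; exact: S_of_beta.
  by rewrite bigcap_image.
have famJ : Y_family KF Y0 J.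
  split.
  (* [J] is nonempty because [val Q] is proper. *)
  - apply: contrapT => nJ; apply: QT; apply/seteqP; split=> // x _.
    apply: contrapT => Qx; apply: nJ; exists (s (qrepr x)), (qrepr x) => //.
    by rewrite /G/= qreprK.
  - by move=> _ [b _ <-]; exact: S_of_beta.
  - move=> _ _ [b1 Gb1 <-] [b2 Gb2 <-].
    (* Irreducibility of [val Q] provides the two sets: [s (qrepr x)] contains [Y0] as [x] is in
       [val Q], and [s (qrepr y)] is in [J] as [y] is not. *)
    have [x [y [Qx Qy]]] := Qdir _ _ Gb1 Gb2.
    rewrite -(qreprK x) -(qreprK y) in Qx Qy *.
    rewrite !qI => /le_qmapE b1c /le_qmapE b2c.
    rewrite !Box_betaI in b1c b2c.
    exists (s (qrepr x)), (s (qrepr y)).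
    split=> //; first exact: S_of_beta; last exact: bigcap_inf.
    by exists (qrepr y).
have meetJ B : J B -> Y0 `&` ~` B !=set0.
  move=> [b Gb <-]; apply: contrapT => nex; apply: Gb.
  have G0 : G !=set0 by exists \top%O.
  have Y0b : Y0 `<=` s b.
    by move=> Y YY; apply: contrapT => Yb; apply: nex; exists Y.
  (* By compactness a single [s a] with [a] in [G] is already inside [s b], so [q a] is below [q b],
     which puts [b] in [G]. *)
  have [a Ga /(le_qmapE hc) ab] := Box_beta_compact G0 GI Y0b.
  exact: (Qup _ _ ab Ga).
have [Y [YY0 YJ]] := S4 SF clY0 famJ meetJ.
exists (val Y); first exact: set_valP.
apply/seteqP; split=> [a Ga|a Ya]; first exact: (YY0 a Ga).
apply: contrapT => Ga; have Ja : J (s a) by exists a.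
exact: (YJ _ Ja).
Qed.

Lemma family_rel_image (Y : set (dual_space A)) : F Y <->
  exists Q : dual_space A', Y = rel_image (quotient_rel hc) Q.
Proof.
split=> [FY|[Q ->]].
  pose Q : dual_space A' := SigSub (mem_set (cover_filter_irreducible FY)).
  exists Q; apply: rel_image_cover => //; apply/seteqP; split=> [a [b Yb ba]|a Ya].
    exact: cover_filter_theta ba Yb.
  by exists a.
have [Y' FY' QY'] := irreducible_cover Q.
by rewrite -(rel_image_cover FY' QY').
Qed.

End Theorem12.

Theorem theorem12 (d : Order.disp_t) (A : tMeetSemilatticeType d)
    (F : set (set (dual_space A))) (hF : lower_Vietoris F) :
  exists hcong : congruence (theta_of F),
    [/\ (forall a, S_of F (Box (mem_rel F) (beta a))),
        sl_hom (fun a : A => Box (mem_rel F) (beta a)),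
        (forall a b, theta_of F a b <->
           Box (mem_rel F) (beta a) = Box (mem_rel F) (beta b)),
        (forall Y : set (dual_space A), F Y <->
           exists Q : dual_space (quotient hcong),
             Y = rel_image (quotient_rel hcong) Q)
      & F = rel_family (quotient_rel hcong)].
Proof.
have hcong := theta_of_congruence F; exists hcong; split.
- exact: S_of_beta.
- by split=> [a b|]; [exact: Box_betaI|exact: Box_beta_top].
- exact: theta_ofE.
- exact: family_rel_image.
- apply/seteqP; split=> [Y /(family_rel_image hF hcong)[Q ->]|_ [Q _ <-]].
    by exists Q.
  by apply/(family_rel_image hF hcong); exists Q.
Qed.
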